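(* Let $s,k\ge 2$ and $q\ge1$ be integers and define $g(t)=g_{s,k}(t)=\sum_{\deg Y=k-1}\sum_{\deg Z=s-1}E(tYZ)$ for $t\in\mathbb{P}$, where $Y,Z$ range over polynomials in $\mathbb{F}_2[T]$ of exact degree $k-1$ and $s-1$. Then for $t\in\mathbb{P}$: $g(t)=2^{s+k-j-2}$ if $r(D_{(s-1)\times(k-1)}(t))=r(D_{s\times(k-1)}(t))=r(D_{(s-1)\times k}(t))=r(D_{s\times k}(t))=j$; $g(t)=-2^{s+k-j-2}$ if $r(D_{(s-1)\times(k-1)}(t))=r(D_{s\times(k-1)}(t))=r(D_{(s-1)\times k}(t))=j$ and $r(D_{s\times k}(t))=j+1$; and $g(t)=0$ otherwise. Moreover $$\int_{\mathbb{P}}g^{2q}(t)\,dt=2^{(s+k-2)(2q-1)}\sum_{j=0}^{s-1}N_j\,2^{-2qj},$$ where $N_j$ is the number of $(\alpha_1,\dots,\alpha_{k+s-1})\in\mathbb{F}_2^{k+s-1}$ such that the four matrices $D_{(s-1)\times(k-1)}$, $D_{(s-1)\times k}$, $D_{s\times(k-1)}$, $D_{s\times k}$ built from $(\alpha_{i+j-1})$ all have rank $j$.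
   Context: $\mathbb{K}=\mathbb{F}_2((T^{-1}))$; $\mathbb{P}=\{t\in\mathbb{K}:|t|<1\}=\{\sum_{i\ge1}\alpha_iT^{-i}\}$ with Haar measure $dt$ normalized so $\int_{\mathbb{P}}dt=1$. $E(t)=(-1)^{\alpha_1}$ where $\alpha_1$ is the coefficient of $T^{-1}$ in $t$. For $t=\sum_{i\ge1}\alpha_iT^{-i}$ and positive integers $a,b$, $D_{a\times b}(t)=(\alpha_{i+j-1})_{1\le i\le a,1\le j\le b}$ (persymmetric matrix over $\mathbb{F}_2$), and $r$ denotes rank over $\mathbb{F}_2$. *)

(* Defs.v *)
From HB Require Import structures.
From mathcomp Require Import all_boot all_order all_algebra.
From mathcomp Require Import all_classical all_reals all_analysis.
From mathcomp Require Import zify ring lra.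

Set Implicit Arguments.
Unset Strict Implicit.
Unset Printing Implicit Defensive.

Import Order.TTheory GRing.Theory Num.Theory.

Local Open Scope classical_set_scope.
Local Open Scope ring_scope.

(* x n is the coefficient of T^n, for n : int; being a Laurent series in T^-1
   means that the support is bounded above. *)
Definition bounded_above (x : int -> 'F_2) (N : int) :=
  forall n : int, N < n -> x n = 0.

Definition laurent_pred : {pred int -> 'F_2} :=
  fun x => `[< exists N : int, bounded_above x N >].

Record laurent := Laurent {
  coefK :> int -> 'F_2 ;
  coefKP : coefK \in laurent_pred }.

HB.instance Definition _ := [isSub for coefK].
HB.instance Definition _ := [Choice of laurent by <:].

Lemma laurent_zmod_closed : zmod_closed laurent_pred.
Proof.
split=> [|x y /asboolP[N xN] /asboolP[M yM]]; apply/asboolP; first by exists 0.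
exists (Num.max N M) => n; rewrite gt_max => /andP[Nn Mn].
by rewrite !fctE xN// yM// subr0.
Qed.

HB.instance Definition _ :=
  GRing.isZmodClosed.Build _ laurent_pred laurent_zmod_closed.
HB.instance Definition _ := [SubChoice_isSubZmodule of laurent by <:].

Lemma laurentP (x y : laurent) : (forall n, x n = y n) -> x = y.
Proof. by move=> xy; apply/val_inj/funext. Qed.

Lemma coefK_bounded (x : laurent) : exists N, bounded_above x N.
Proof. by have /asboolP := coefKP x. Qed.

Lemma coefK0 n : (0 : laurent) n = 0. Proof. by []. Qed.
Lemma coefKD (x y : laurent) n : (x + y) n = x n + y n. Proof. by []. Qed.

(* Cauchy product; the summand has finite support when x and y are bounded
   above. *)
Definition conv (x y : int -> 'F_2) (n : int) : 'F_2 :=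
  \sum_(i \in [set: int]) x i * y (n - i).

Lemma convE (x y : int -> 'F_2) (X Y : int) (m : nat) :
  bounded_above x X -> bounded_above y Y ->
  conv x y (X + Y - m%:Z) = \sum_(i < m.+1) x (X - i%:Z) * y (Y - (m - i)%N%:Z).
Proof.
move=> xX yY; rewrite /conv.
rewrite -(fsbig_widen [set X - i%:Z | i in `I_m.+1]) //; last first.
  move=> i [_ /= Hi]; case: (ltP X i) => [Xi|iX]; first by rewrite xX ?mul0r.
  rewrite yY ?mulr0//; rewrite ltNge; apply/negP => H; apply: Hi.
  by exists `|X - i|%N; rewrite /=; lia.
rewrite fsbig_image; last by move=> i j _ _ /=; lia.
rewrite -fsbig_ord; apply: eq_bigr => i _ /=; congr (_ * y _).
have := ltn_ord i; lia.
Qed.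

Lemma conv_bounded (x y : int -> 'F_2) (X Y : int) :
  bounded_above x X -> bounded_above y Y -> bounded_above (conv x y) (X + Y).
Proof.
move=> xX yY n XYn; apply: fsbig1 => i _ /=.
case: (ltP X i) => [Xi|iX]; first by rewrite xX ?mul0r.
by rewrite yY ?mulr0//; lia.
Qed.

Lemma conv_laurent (x y : laurent) : conv x y \in laurent_pred.
Proof.
have [[N xN] [M yM]] := (coefK_bounded x, coefK_bounded y).
by apply/asboolP; exists (N + M); exact: conv_bounded.
Qed.

Definition mulK (x y : laurent) : laurent := Laurent (conv_laurent x y).

Lemma coef_poly_laurent (p : {poly 'F_2}) :
  (fun n : int => if n is Posz m then p`_m else 0) \in laurent_pred.
Proof.
apply/asboolP; exists (size p)%:Z => -[m|m]//.
by rewrite ltz_nat => /ltnW pm; rewrite nth_default.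
Qed.

Definition polyK (p : {poly 'F_2}) : laurent := Laurent (coef_poly_laurent p).

Local Definition trunc (x : int -> 'F_2) (N : int) (m : nat) : {poly 'F_2} :=
  \poly_(i < m.+1) x (N - i%:Z).

Local Lemma coef_trunc (x : int -> 'F_2) N m i : (i <= m)%N ->
  (trunc x N m)`_i = x (N - i%:Z).
Proof. by move=> im; rewrite coef_poly ltnS im. Qed.

Local Lemma conv_trunc (x y : int -> 'F_2) X Y (m i : nat) : (i <= m)%N ->
  bounded_above x X -> bounded_above y Y ->
  conv x y (X + Y - i%:Z) = (trunc x X m * trunc y Y m)`_i.
Proof.
move=> im xX yY; rewrite convE// coefM; apply: eq_bigr => j _.
by have := ltn_ord j => ji; rewrite !coef_trunc//; lia.
Qed.

Local Lemma conv_ext (x y : int -> 'F_2) (N : int) :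
  bounded_above x N -> bounded_above y N ->
  (forall m : nat, x (N - m%:Z) = y (N - m%:Z)) -> x = y.
Proof.
move=> xN yN xy; apply/funext => n; case: (ltP N n) => [Nn|nN].
  by rewrite xN ?yN.
by have -> : n = N - `|N - n|%N%:Z by lia.
Qed.

Lemma mulKC : commutative mulK.
Proof.
move=> x y; apply: val_inj => /=.
have [[N xN] [M yM]] := (coefK_bounded x, coefK_bounded y).
have yxNM := conv_bounded yM xN; rewrite addrC in yxNM.
apply: (conv_ext (conv_bounded xN yM) yxNM) => m.
rewrite (conv_trunc (leqnn _) xN yM) mulrC addrC (addrC N).
by rewrite -(conv_trunc (leqnn _) yM xN) addrC.
Qed.

Lemma mulKA : associative mulK.
Proof.
move=> x y z; apply: val_inj => /=.
have [[[N xN] [M yM]] [L zL]] :=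
  (coefK_bounded x, coefK_bounded y, coefK_bounded z).
have yzML := conv_bounded yM zL; have xyNM := conv_bounded xN yM.
have h := conv_bounded xN yzML; rewrite addrA in h.
apply: (conv_ext h (conv_bounded xyNM zL)) => m.
rewrite (conv_trunc (leqnn _) xyNM zL) -addrA (conv_trunc (leqnn _) xN yzML).
transitivity ((trunc x N m * (trunc y M m * trunc z L m))`_m).
  rewrite !coefM; apply: eq_bigr => i _; congr (_ * _).
  by rewrite coef_trunc ?leq_subr// (conv_trunc (leq_subr _ _) yM zL).
rewrite mulrA [LHS]coefM [RHS]coefM; apply: eq_bigr => i _; congr (_ * _).
have im : (i <= m)%N by have := ltn_ord i; lia.
by rewrite coef_trunc// (conv_trunc im xN yM).
Qed.

Lemma mul1K : left_id (polyK 1) mulK.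
Proof.
move=> x; apply: laurentP => n /=; rewrite /conv.
have z i : i != 0 -> (if i is Posz m then (1 : {poly 'F_2})`_m else 0) *
    x (n - i) = 0.
  by case: i => [[|i]|i]//; rewrite ?coef1 ?mul0r.
rewrite -(fsbig_widen [set 0]) => [|//|i [_ /eqP/z]//].
by rewrite fsbig_set1 /= coef1 mul1r subr0.
Qed.

Lemma mulKDl : left_distributive mulK +%R.
Proof.
move=> x y z; apply: val_inj => /=.
have [[[N xN] [M yM]] [L zL]] :=
  (coefK_bounded x, coefK_bounded y, coefK_bounded z).
pose B := Num.max N M.
have {}xN : bounded_above x B by move=> n Bn; apply: xN; lia.
have {}yM : bounded_above y B by move=> n Bn; apply: yM; lia.
have xyB : bounded_above (x + y : laurent) B.
  by move=> n Bn; rewrite coefKD xN ?yM ?addr0.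
apply: (conv_ext (conv_bounded xyB zL)) => [n Bn|m].
  by rewrite fctE (conv_bounded xN zL) ?(conv_bounded yM zL) ?addr0.
rewrite fctE !convE// -big_split; apply: eq_bigr => i _; exact: mulrDl.

Qed.

Lemma oneK_neq0 : polyK 1 != 0.
Proof.
by apply/eqP => /(congr1 (fun x : laurent => x 0)) /=; rewrite coef1.
Qed.

HB.instance Definition _ := GRing.Zmodule_isComNzRing.Build laurent
  mulKA mulKC mul1K mulKDl oneK_neq0.

(* |x| = 2^n when n is the degree of the leading term of x, and |0| = 0 by the
   default value of xget. *)
Definition absK (x : laurent) : rat :=
  xget 0 [set r | exists n : int,
    [/\ x n != 0, bounded_above x n & r = 2%:Q ^ n]].

Definition unit_ball : {pred laurent} := fun x => `[< absK x < 1 >].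

Lemma lead_uniq (x : int -> 'F_2) (n m : int) : x n != 0 -> bounded_above x n ->
  x m != 0 -> bounded_above x m -> n = m.
Proof.
move=> xn bn xm bm; apply/eqP; rewrite eq_le.
apply/andP; split; rewrite leNgt; apply/negP.
  by move/bm/eqP; apply/negP.
by move/bn/eqP; apply/negP.
Qed.

Lemma absKE (x : laurent) (n : int) : x n != 0 -> bounded_above x n ->
  absK x = 2%:Q ^ n.
Proof.
move=> xn bn; rewrite /absK; case: xgetP => [r _ /= [m [xm bm ->]]|].
  by rewrite (lead_uniq xn bn xm bm).
by move=> /(_ (2%:Q ^ n)) []; exists n.
Qed.

Lemma absK0 : absK 0 = 0.
Proof. by rewrite /absK; case: xgetP => // r _ /= [m [/eqP]]. Qed.

Lemma lead_ex (x : laurent) : x != 0 ->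
  exists2 n : int, x n != 0 & bounded_above x n.
Proof.
move=> x0; have [N xN] := coefK_bounded x.
have [i xi] : exists i : nat, x (N - i%:Z) != 0.
  apply: contrapT => /forallNP h; move/eqP: x0; apply; apply: val_inj => /=.
  by apply: (conv_ext xN) => // m; apply/eqP/negPn/negP/h.
have ex : exists i : nat, x (N - i%:Z) != 0 by exists i.
exists (N - (ex_minn ex)%:Z); case: ex_minnP => // m xm min_m.
move=> n mn; apply/eqP/negPn/negP => xn0.
case: (ltP N n) => [/xN xn|nN]; first by rewrite xn eqxx in xn0.
have h : N - `|N - n|%N%:Z = n by lia.
by have := min_m `|N - n|%N; rewrite h => /(_ xn0); lia.
Qed.

Lemma absK_lt_exp (x : laurent) (n : int) :
  (absK x < 2%:Q ^ n) <-> forall m, n <= m -> x m = 0.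
Proof.
have [->|x0] := eqVneq x 0.
  by rewrite absK0 exprz_gt0.
have [d xd bd] := lead_ex x0; rewrite (absKE xd bd) ltr_eXz2l//.
split=> [dn m nm|h]; first by apply: bd; exact: lt_le_trans nm.
by rewrite ltNge; apply/negP => /h /eqP; apply/negP.
Qed.

Lemma unit_ballP (x : laurent) :
  reflect (forall n : int, 0 <= n -> x n = 0) (x \in unit_ball).
Proof.
by apply: (iffP (asboolP _)) => h; apply/(absK_lt_exp x 0).
Qed.

Lemma unit_ball_zmod_closed : zmod_closed unit_ball.
Proof.
split=> [|x y /unit_ballP x0 /unit_ballP y0]; apply/unit_ballP => // n n0.
by rewrite (_ : (x - y) n = x n - y n)// x0// y0// subr0.
Qed.

HB.instance Definition _ :=
  GRing.isZmodClosed.Build _ unit_ball unit_ball_zmod_closed.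

Record PP := MkPP { PPval :> laurent ; PPvalP : PPval \in unit_ball }.

HB.instance Definition _ := [isSub for PPval].
HB.instance Definition _ := [Choice of PP by <:].
HB.instance Definition _ := [SubChoice_isSubZmodule of PP by <:].
HB.instance Definition _ := isPointed.Build PP 0.

Definition openPP : set_system PP := [set U | forall t : PP, U t ->
  exists2 e : rat, 0 < e & forall u : PP, absK (u - t) < e -> U u].

Lemma openPPT : openPP setT. Proof. by move=> t _; exists 1. Qed.

Lemma openPPI : setI_closed openPP.
Proof.
move=> A B oA oB t [/oA[a a0 Aa] /oB[b b0 Bb]].
exists (Num.min a b); first by rewrite lt_min a0.
by move=> u; rewrite lt_min => /andP[/Aa ? /Bb].
Qed.

Lemma openPP_bigU (I : Type) (f : I -> set PP) :
  (forall i, openPP (f i)) -> openPP (\bigcup_i f i).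
Proof.
move=> opf t [i _ /opf [e e0 fe]]; exists e => // u /fe; by exists i.
Qed.

HB.instance Definition _ :=
  isOpenTopological.Build PP openPPT openPPI openPP_bigU.

HB.instance Definition _ := @isMeasurable.Build (sigma_display (@open PP)) PP
  <<s @open PP >> (@sigma_algebra0 _ setT _) (@sigma_algebraC _ _)
  (@sigma_algebra_bigcup _ setT _).

(* On the compact metrizable group PP, invariance under translation and total
   mass 1 determine the Borel measure mu; see haar_exists for existence. *)
Definition is_haar (R : realType) (mu : {measure set PP -> \bar R}) :=
  (forall (u : PP) (A : set PP), measurable A ->
    mu [set u + t | t in A] = mu A) /\ mu [set: PP] = 1%E.

Definition cyl (w : seq 'F_2) : set PP :=
  [set t : PP | forall i, (i < size w)%N -> t (- i.+1%:Z) = w`_i].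

Definition cyls : set (set PP) := [set A | A = set0 \/ exists w, A = cyl w].

Lemma open_cyl w : open (cyl w).
Proof.
move=> t tw; exists (2%:Q ^ (- (size w)%:Z)); first exact: exprz_gt0.
move=> u /absK_lt_exp ut i iw; rewrite -tw//.
have /eqP : (u - t : PP) (- i.+1%:Z) = 0 by apply: ut; lia.
by rewrite (_ : (u - t : PP) _ = u (- i.+1%:Z) - t (- i.+1%:Z))// subr_eq0 => /eqP.
Qed.

Lemma measurable_cyls : measurable = <<s cyls >> :> set (set PP).
Proof.
apply/seteqP; split; last first.
  apply: smallest_sub; first exact: sigma_algebra_measurable.
  move=> A [->|[w ->]]; first exact: measurable0.
  by apply: sub_sigma_algebra; exact: open_cyl.
apply: smallest_sub; first exact: smallest_sigma_algebra.
move=> U oU.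
have -> : U = \bigcup_(w : seq 'F_2) (if `[< cyl w `<=` U >] then cyl w else set0).
  apply/seteqP; split=> [t Ut|t [w _]]; last by case: asboolP => // wU /wU.
  have [e e0 eU] := oU _ Ut.
  have [n ne] : exists n : nat, 2%:Q ^ (- n%:Z) < e.
    exists (Num.bound e^-1); rewrite -exprnN invf_plt ?posrE ?exprn_gt0//.
    have /lt_trans -> // : e^-1 < (Num.bound e^-1)%:R.
      by apply: archi_boundP; rewrite invr_ge0 ltW.
    by rewrite -natrX ltr_nat ltn_expl.
  exists (mkseq (fun i => t (- i.+1%:Z)) n) => //; case: asboolP => [_ i|[]].
    by rewrite size_mkseq => im; rewrite nth_mkseq.
  move=> u ut; apply: eU; apply: lt_trans ne; apply/absK_lt_exp => m nm.
  case: (leP 0 m) => m0; first exact: (elimT (unit_ballP _) (PPvalP _)).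
  have mE : m = - (`|m|%N.-1).+1%:Z by lia.
  have := ut `|m|%N.-1; rewrite size_mkseq.
  have mn : (`|m|.-1 < n)%N by lia.
  rewrite nth_mkseq// -mE => /(_ mn) um.
  by rewrite (_ : (u - t : PP) m = u m - t m)// um subrr.
apply: (@countable_bigcupT_measurable _ (g_sigma_algebraType cyls)) => // w.
by case: ifP => _; [apply: sub_sigma_algebra; right; exists w|exact: measurable0].
Qed.

Lemma setI_cyls : setI_closed cyls.
Proof.
move=> A B [->|[v ->]]; first by left; rewrite set0I.
move=> [->|[w ->]]; first by left; rewrite setI0.
wlog vw : v w / (size v <= size w)%N => [h|].
  by have [/h//|/ltnW/h] := leqP (size v) (size w); rewrite setIC.
have [[t [tv tw]]|h] := pselect (cyl v `&` cyl w !=set0).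
  right; exists w; apply/seteqP; split=> [u []//|u uw]; split=> // i iv.
  by rewrite uw ?(leq_trans iv)// -tw ?(leq_trans iv)// tv.
by left; apply/eqP/negPn/negP => /set0P.
Qed.

Lemma cyl0 : cyl [::] = setT. Proof. by apply/seteqP; split. Qed.

Section haar_existence.
Context (R : realType).

Let dig (x : R) (i : nat) : 'F_2 := (Num.floor (x * 2 ^+ i))%:~R.

Let digP x : (fun n : int => if n is Negz i then dig x i.+1 else 0) \in laurent_pred.
Proof. by apply/asboolP; exists 0 => -[[|n]|n]. Qed.

Let digPP x : Laurent (digP x) \in unit_ball.
Proof. by apply/unit_ballP => -[n|n]. Qed.

Let phi x : PP := MkPP (digPP x).

Let phi_cyl w : phi @^-1` cyl w =
  [set x | forall i, (i < size w)%N -> dig x i.+1 = w`_i].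
Proof. by []. Qed.

Let floorE (n : nat) (m : int) : [set x : R | Num.floor (x * 2 ^+ n) = m] =
  `[m%:~R / 2 ^+ n, (m + 1)%:~R / 2 ^+ n[%classic.
Proof.
have n0 : 0 < 2 ^+ n :> R by rewrite exprn_gt0.
apply/seteqP; split=> x /=.
  by move=> <-; rewrite in_itv/= ler_pdivrMr// ltr_pdivlMr// floor_itv.
by rewrite in_itv/= ler_pdivrMr// ltr_pdivlMr// => /floor_def.
Qed.

Let mphi : measurable_fun setT phi.
Proof.
apply: (measurability _ measurable_cyls) => _ [_ [->|[w ->]] <-].
  by rewrite preimage_set0 setI0.
rewrite setTI phi_cyl.
have -> : [set x | forall i, (i < size w)%N -> dig x i.+1 = w`_i] =
  \bigcap_(i in `I_(size w)) [set x | dig x i.+1 = w`_i] by [].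
apply: bigcap_measurableType => i _.
have -> : [set x | dig x i.+1 = w`_i] = \bigcup_(m : int)
   (if m%:~R == w`_i then [set x : R | Num.floor (x * 2 ^+ i.+1) = m] else set0).
  apply/seteqP; split=> [x /= xw|x [m _]].
    by exists (Num.floor (x * 2 ^+ i.+1)) => //; rewrite /dig in xw; rewrite xw eqxx.
  by case: eqP => // mw /= xm; rewrite /dig xm.
apply: countable_bigcupT_measurable => // m.
by case: ifP => // _; rewrite floorE.
Qed.

Let mI : measurable (`[0, 1[%classic : set R). Proof. exact: measurable_itv. Qed.

Let lam : {measure set (measurableTypeR R) -> \bar R} :=
  mrestr lebesgue_measure mI.

Let coin : {measure set PP -> \bar R} :=
  measure_function_pushforward__canonical__measure_function_Measure lam mphi.

Let floor_double (y : R) (m : nat) (b : 'F_2) :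
  Num.floor y = m%:Z /\ (Num.floor (y * 2))%:~R = b <->
  Num.floor (y * 2) = (m.*2 + b)%N%:Z.
Proof.
have b2 : (b < 2)%N := ltn_ord b.
have /andP[y1 y2] := floor_itv y; have /andP[z1 z2] := floor_itv (y * 2).
have h1 : Num.floor (y * 2) < Num.floor y * 2 + 2.
  by rewrite -(ltr_int R) rmorphD rmorphM /=; rewrite rmorphD/= in y2; lra.
have h2 : Num.floor y * 2 < Num.floor (y * 2) + 1.
  by rewrite -(ltr_int R) rmorphM/=; lra.
split=> [[ym yb]|yb].
  have hz : (0 <= Num.floor (y * 2))%R by lia.
  have hb : b = (`|Num.floor (y * 2)| %% 2)%N :> nat.
    by rewrite -(@val_Fp_nat 2)// -yb -[in LHS](gez0_abs hz).
  lia.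
split; first by lia.
rewrite yb; apply: val_inj => /=; rewrite -pmulrn val_Fp_nat//.
lia.
Qed.

Let cylE w : exists2 m : nat, (m < 2 ^ size w)%N &
  phi @^-1` cyl w `&` `[0, 1[%classic =
  [set x : R | Num.floor (x * 2 ^+ size w) = m%:Z].
Proof.
rewrite phi_cyl; elim/last_ind: w => [|w b [m mw IH]].
  exists 0%N => //; rewrite floorE expr0 !divr1/= add0r.
  by apply/seteqP; split=> [x []|x ?]; last split.
exists (m.*2 + b)%N.
  rewrite size_rcons expnS; have b2 : (b < 2)%N := ltn_ord b.
  lia.
transitivity ([set x : R | Num.floor (x * 2 ^+ size w) = m%:Z] `&`
   [set x : R | dig x (size w).+1 = b]).
  rewrite -IH; apply/seteqP; split=> x.
    move=> [xw x01]; split; first (split=> //).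
      by move=> i iw; rewrite xw ?size_rcons ?(leqW iw)// nth_rcons iw.
    by rewrite /= xw ?size_rcons// nth_rcons ltnn eqxx.
  move=> [[xw x01] xb]; split=> // i; rewrite size_rcons ltnS nth_rcons leq_eqVlt.
  by case: ltngtP => //= [iw _|->]; first exact: xw.
apply/seteqP; split=> x; rewrite /dig size_rcons /= exprSr mulrA.
  by move=> ?; apply/floor_double.
by move=> xm; apply/floor_double.
Qed.

Let coin_cyl w : coin (cyl w) = ((2 ^- size w)%:E).
Proof.
rewrite /coin /= /pushforward /lam /= /mrestr.
have [m _ ->] := cylE w; rewrite floorE lebesgue_measure_itv /= lte_fin.
rewrite ltr_pM2r ?invr_gt0 ?exprn_gt0// ltr_int (_ : _ < _ + 1)%R; last lia.
by rewrite -EFinB -mulrBl -rmorphB /= addrAC subrr add0r mul1r.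
Qed.

Let sub_cyl (u : PP) w : exists2 v, size v = size w &
  (fun t : PP => t - u) @^-1` cyl w = cyl v.
Proof.
exists (mkseq (fun i => w`_i + u (- i.+1%:Z)) (size w)); first exact: size_mkseq.
apply/seteqP; split=> t; rewrite /cyl /= size_mkseq => tw i iw.
  rewrite nth_mkseq//.
  by have <- : t (- i.+1%:Z) - u (- i.+1%:Z) = w`_i := tw i iw; rewrite subrK.
change (t (- i.+1%:Z) - u (- i.+1%:Z) = w`_i).
by rewrite tw// nth_mkseq// addrK.
Qed.

Let measurable_sub (u : PP) : measurable_fun setT (fun t : PP => t - u).
Proof.
apply: (measurability _ measurable_cyls) => _ [_ [->|[w ->]] <-].
  by rewrite preimage_set0 setI0.
rewrite setTI; have [v _ ->] := sub_cyl u w.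
by apply: sub_sigma_algebra; exact: open_cyl.
Qed.

Lemma haar_exists : exists mu : {measure set PP -> \bar R}, is_haar mu.
Proof.
exists coin; split; last by rewrite -cyl0 coin_cyl expr0 invr1.
move=> u A mA.
have -> : [set u + t | t in A] = (fun t : PP => t - u) @^-1` A.
  apply/seteqP; split=> [_ [t At <-]|t At] /=; first by rewrite addrC addKr.
  by exists (t - u) => //; rewrite addrC subrK.
apply: (@measure_unique _ R PP cyls (fun=> setT) measurable_cyls setI_cyls _ _
  (measure_function_pushforward__canonical__measure_function_Measure coin
    (measurable_sub u)) coin) => //.
- by move=> _; right; exists [::]; rewrite cyl0.
- by apply/seteqP; split=> // t _; exists 0%N.
- move=> _ [->|[w ->]]; first by rewrite !measure0.
  have [v vw vE] := sub_cyl u w.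
  by transitivity (coin (cyl v)); [rewrite -vE|rewrite !coin_cyl vw].
- by move=> _; change (coin setT < +oo)%E; rewrite -cyl0 coin_cyl ltry.
Qed.

End haar_existence.

Definition charE (x : laurent) : int := (-1) ^+ (x (-1) : nat).

Definition gsum (s k : nat) (t : laurent) : int :=
  \sum_(Y \in [set Y : {poly 'F_2} | size Y = k])
    \sum_(Z \in [set Z : {poly 'F_2} | size Z = s])
      charE (t * polyK Y * polyK Z).

(* alpha is indexed from 1, the matrix indices i and j from 0. *)
Definition persym (a b : nat) (alpha : nat -> 'F_2) : 'M['F_2]_(a, b) :=
  \matrix_(i < a, j < b) alpha (i + j).+1.

Definition digits (t : laurent) (i : nat) : 'F_2 := t (- i%:Z).

Definition equal_ranks (s k : nat) (alpha : nat -> 'F_2) (j : nat) : bool :=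
  [&& \rank (persym s.-1 k.-1 alpha) == j,
      \rank (persym s k.-1 alpha) == j,
      \rank (persym s.-1 k alpha) == j &
      \rank (persym s k alpha) == j].

Definition jump_ranks (s k : nat) (alpha : nat -> 'F_2) (j : nat) : bool :=
  [&& \rank (persym s.-1 k.-1 alpha) == j,
      \rank (persym s k.-1 alpha) == j,
      \rank (persym s.-1 k alpha) == j &
      \rank (persym s k alpha) == j.+1].

Definition num_equal_ranks (s k j : nat) : nat :=
  #|[pred v : (k + s - 1).-tuple 'F_2 |
      equal_ranks s k (fun i => v`_i.-1) j]|.

(* Main.v *)
(** Write [s = m+1], [k = n+1].  Fixing the leading coefficients of [Y] and [Z] to
    be 1 turns [g(t)] into the sum over [w], [u] of the character
    [(-1)^(u A w + u c + r w + d)], where [A = D_(m x n)(t)] is bordered by its last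
    column [c], last row [r] and corner [d] inside [D_(s x k)(t)].  Summing over [u]
    (resp. [w]) kills everything unless [c] (resp. [r]) lies in the column (resp.
    row) space of [A], i.e. unless bordering by [c] or [r] preserves the rank.
    If [c = A y] and [r = x A], translating [u], [w] by [x], [y] leaves the sign of
    [d - x c] times the bilinear sum, which is [2^m] times the size of the kernel of
    [A]; and [d = x c] is exactly the condition that the corner does not raise the
    rank.

    For the integral, [g] only depends on the first [s+k-1] digits, all of whose
    cylinders have the same Haar measure by translation invariance.  The last digit
    occurs only as the corner [d], so flipping it exchanges the two nonzero cases. *)

Require Import Defs.
From HB Require Import structures.
From mathcomp Require Import all_boot all_order all_algebra.
From mathcomp Require mxabelem.
From mathcomp Require Import all_classical all_reals all_analysis measurable_realfun.
From mathcomp Require Import zify ring.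

Set Implicit Arguments.
Unset Strict Implicit.
Unset Printing Implicit Defensive.

Import Order.TTheory GRing.Theory Num.Theory.

Local Open Scope classical_set_scope.
Local Open Scope ring_scope.

(** * Quadratic character sums over [F_2] *)

Definition F2char (x : 'F_2) : int := (-1) ^+ (x : nat).

Lemma F2_case (x : 'F_2) : (x == 0) || (x == 1).
Proof. by case: x => [[|[|]]]. Qed.

Lemma F2charD (x y : 'F_2) : F2char (x + y) = F2char x * F2char y.
Proof. by case/orP: (F2_case x) => /eqP->; case/orP: (F2_case y) => /eqP->. Qed.

Lemma F2charE (x : 'F_2) : F2char x = if x == 0 then 1 else -1.
Proof. by case/orP: (F2_case x) => /eqP->. Qed.

(* Translating by a u0 with F2char (f u0) = -1 negates the sum. *)
Lemma F2char_sum (V : finZmodType) (f : V -> 'F_2) :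
  {morph f : x y / x + y} -> (exists u, f u != 0) ->
  \sum_(u : V) F2char (f u) = 0.
Proof.
move=> fD [u0 fu0].
have h : \sum_(u : V) F2char (f u) = - \sum_(u : V) F2char (f u).
  rewrite [LHS](reindex_inj (addrI u0)) -sumrN; apply: eq_bigr => u _.
  by rewrite fD F2charD {1}F2charE (negPf fu0) mulN1r.
lia.
Qed.

Lemma F2char_sum_row m (v : 'cV['F_2]_m) :
  \sum_(u : 'rV_m) F2char ((u *m v) 0 0) = if v == 0 then 2 ^+ m else 0.
Proof.
have [->|v0] := eqVneq v 0.
  under eq_bigr do rewrite mulmx0 mxE F2charE eqxx.
  by rewrite sumr_const card_mx card_Fp// mul1n natrX.
apply: (F2char_sum (f := fun u : 'rV_m => (u *m v) 0 0)).
  by move=> x y; rewrite mulmxDl mxE.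
have [i vi] : exists i, v i 0 != 0.
  apply/existsP; apply: contraNT v0; rewrite negb_exists => /forallP h.
  by apply/eqP/colP => i; rewrite mxE; apply/eqP/negPn/h.
by exists (delta_mx 0 i); rewrite -rowE mxE.
Qed.

Lemma F2char_sum_col n (v : 'rV['F_2]_n) :
  \sum_(u : 'cV_n) F2char ((v *m u) 0 0) = if v == 0 then 2 ^+ n else 0.
Proof.
rewrite (reindex_onto trmx trmx) => [|u _]; last exact: trmxK.
rewrite (eq_bigl predT) => [|u]; last by rewrite trmxK eqxx.
rewrite -(trmx_eq0 v) -F2char_sum_row; apply: eq_bigr => u _.
by congr F2char; rewrite -[v in LHS]trmxK -trmx_mul mxE.
Qed.

(** Transposition turns the right kernel into the row space of [kermx A^T], whose rank is
    [n - \rank A]. *)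
Lemma card_right_kernel (F : finFieldType) m n (A : 'M[F]_(m, n)) :
  #|[pred w : 'cV_n | A *m w == 0]| = (#|F| ^ (n - \rank A))%N.
Proof.
rewrite -(mxrank_tr A) -mxrank_ker -mxabelem.card_rowg.
rewrite -(card_imset _ (@trmx_inj F n 1)).
apply: eq_card => u; rewrite mxabelem.mem_rowg; apply/imsetP/sub_kermxP.
  by case=> w; rewrite !inE => /eqP Aw ->; rewrite -trmx_mul Aw trmx0.
move=> uA; exists u^T; last by rewrite trmxK.
by rewrite !inE -trmx_eq0 trmx_mul trmxK uA.
Qed.

(** Summing over [u] first leaves [2 ^+ m] for each [w] in the right kernel of [A] and nothing
    elsewhere. *)
Lemma bilinear_F2char_sum m n (A : 'M['F_2]_(m, n)) :
  \sum_(w : 'cV_n) \sum_(u : 'rV_m) F2char ((u *m A *m w) 0 0) =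
  2 ^+ (m + (n - \rank A)).
Proof.
under eq_bigr => w _ do
  (under eq_bigr do rewrite -mulmxA; rewrite F2char_sum_row).
rewrite -big_mkcond sumr_const card_right_kernel card_Fp// exprD.
by rewrite -[in RHS](natrX _ 2 (n - _)) mulr_natr.
Qed.

(** The exponent is the form of [block_mx A c r d] evaluated at the row [(u, 1)] and the column
    [(w, 1)]. *)
Definition affine_F2char_sum m n (A : 'M['F_2]_(m, n)) (c : 'cV_m) (r : 'rV_n)
    (d : 'M['F_2]_1) : int :=
  \sum_(w : 'cV_n) \sum_(u : 'rV_m)
    F2char ((u *m A *m w + u *m c + r *m w + d) 0 0).

(** * Ranks of bordered matrices *)

Section block_rank.
Context (F : fieldType) (m n : nat).
Implicit Types (A : 'M[F]_(m, n)) (c : 'cV[F]_m) (r : 'rV[F]_n).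

Lemma rank_col_mxP A r :
  reflect (exists x : 'rV_m, x *m A = r) (\rank (col_mx A r) == \rank A).
Proof.
rewrite eq_sym (mxrank_leqif_sup _).2 ?col_mx_sub ?submx_refl/=; last first.
  by rewrite -addsmxE addsmxSl.
by apply: (iffP submxP) => -[x]; exists x.
Qed.

Lemma rank_row_mxP A c :
  reflect (exists x : 'cV_n, A *m x = c) (\rank (row_mx A c) == \rank A).
Proof.
rewrite -mxrank_tr -(mxrank_tr A) tr_row_mx.
rewrite eq_sym (mxrank_leqif_sup _).2 ?col_mx_sub ?submx_refl/=; last first.
  by rewrite -addsmxE addsmxSl.
apply: (iffP submxP) => -[x xA]; exists x^T; apply: trmx_inj.
  by rewrite trmx_mul trmxK.
by rewrite trmx_mul !trmxK.
Qed.

(** Block elimination: unitriangular factors clear both borders and leave [A] with the Schur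
    complement [d - x *m c], where [x] stands in for [r *m A^-1], which need not exist. *)
Lemma rank_block_mx A c r d (x : 'rV_m) (y : 'cV_n) : x *m A = r -> A *m y = c ->
  \rank (block_mx A c r d) = (\rank A + ((d - x *m c) 0 0 != 0)%R)%N.
Proof.
move=> xA Ay; set e := d - x *m c.
have -> : (e 0 0 != 0) = (e != 0).
  congr (~~ _); apply/eqP/eqP => [e0|->]; last by rewrite mxE.
  by apply/matrixP => i j; rewrite !ord1 e0 mxE.
rewrite -rank_rV -rank_diag_block_mx.
pose L := block_mx (1%:M : 'M[F]_m) 0 x (1%:M : 'M[F]_1).
pose U := block_mx (1%:M : 'M[F]_n) y 0 (1%:M : 'M[F]_1).
have -> : block_mx A c r d = L *m block_mx A 0 0 e *m U.
  rewrite !mulmx_block !mul1mx !mulmx1 !mul0mx !mulmx0 !addr0 !add0r xA Ay.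
  by rewrite -xA -mulmxA Ay addrC /e subrK.
rewrite mxrankMfree ?row_free_unit ?unitmxE ?det_ublock ?det1 ?mulr1 ?unitr1//.
rewrite eqmxMfull// row_full_unit unitmxE det_lblock !det1 mulr1 unitr1 //.
Qed.

End block_rank.

Lemma affine_F2char_sumE m n (A : 'M['F_2]_(m, n)) c r d :
  affine_F2char_sum A c r d =
  if (\rank (row_mx A c) == \rank A) && (\rank (col_mx A r) == \rank A) then
    (if \rank (block_mx A c r d) == \rank A then 1 else -1) *
    2 ^+ (m + (n - \rank A))
  else 0.
Proof.
have [/rank_row_mxP [y Ay]|/rank_row_mxP nc] /= := boolP (_ == _); last first.
  rewrite /affine_F2char_sum big1// => w _.
  under eq_bigr do rewrite -addrA mxE F2charD -mulmxA -mulmxDr.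
  (* A surviving [w] satisfies [A *m w + c = 0], so [- w] solves the system excluded by [nc]. *)
  rewrite -big_distrl /= F2char_sum_row; case: eqP => [Aw|]; last by rewrite mul0r.
  by case: nc; exists (- w); rewrite mulmxN; apply/eqP; rewrite eqr_oppLR -addr_eq0 Aw.
have [/rank_col_mxP [x xA]|/rank_col_mxP nr] := boolP (_ == _); last first.
  rewrite /affine_F2char_sum exchange_big big1// => u _.
  under eq_bigr do rewrite (addrAC (_ *m _ *m _)) -(addrA (_ + _)) mxE F2charD -mulmxDl.
  rewrite -big_distrl /= F2char_sum_col; case: eqP => [uA|]; last by rewrite mul0r.
  by case: nr; exists (- u); rewrite mulNmx; apply/eqP; rewrite eqr_oppLR -addr_eq0 uA.
rewrite (rank_block_mx _ xA Ay) -[X in _ == X]addn0 eqn_add2l eqb0 negbK -F2charE.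
(* Translating [w] by [- y] and [u] by [- x] cancels all linear terms, since [A *m y = c] and
   [x *m A = r], and leaves the constant [d - x *m c]. *)
rewrite -bilinear_F2char_sum /affine_F2char_sum (reindex_inj (addrI (- y))).
rewrite big_distrr; apply: eq_bigr => w _ /=.
rewrite (reindex_inj (addrI (- x))) big_distrr; apply: eq_bigr => u _ /=.
rewrite -F2charD; congr F2char.
have addE (M N : 'M['F_2]_1) : (M + N) 0 0 = M 0 0 + N 0 0 by rewrite mxE.
have oppE (M : 'M['F_2]_1) : (- M) 0 0 = - M 0 0 by rewrite mxE.
rewrite -xA -Ay !mulmxDl !mulmxDr !mulNmx !mulmxN !mulmxA.
by rewrite !(addE, oppE); ring.
Qed.

(** * The sum [g] as a character sum *)

Lemma fsbig_finType (T : finType) (I : choiceType) (R : nmodType) (Q : set I)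
    (h : T -> I) (F : I -> R) :
  set_bij setT Q h -> \sum_(i \in Q) F i = \sum_(x : T) F (h x).
Proof.
move=> hQ; rewrite (reindex_fsbig _ _ _ _ hQ) (fsbig_fwiden (index_enum T))//.
- by move=> x _ /=; rewrite mem_index_enum.
- exact: index_enum_uniq.
- by move=> x [_ []].
Qed.

Lemma row_rVpolyDXn n (v : 'rV['F_2]_n) :
  \row_(i < n + 1) (rVpoly v + 'X^n)`_i = row_mx v 1%:M.
Proof.
apply/rowP => i; rewrite !mxE coefD coefXn; case: splitP => k ->.
  by rewrite coef_rVpoly_ord ltn_eqF ?addr0.
by rewrite ord1 addn0 eqxx nth_default ?add0r ?size_poly// mxE.
Qed.

Lemma size_rVpolyDXn n (v : 'rV['F_2]_n) : size (rVpoly v + 'X^n) = n.+1.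
Proof.
by rewrite addrC size_polyDl size_polyXn// ltnS size_poly.
Qed.

(** Over ['F_2] a nonzero leading coefficient is 1, so only the lower [n] coefficients, packed in
    [v], are free. *)
Lemma size_polyF2_bij n :
  set_bij setT [set Y : {poly 'F_2} | size Y = n.+1]
    (fun v : 'rV['F_2]_n => rVpoly v + 'X^n).
Proof.
split.
- by move=> v _; exact: size_rVpolyDXn.
- by move=> v w _ _ /addIr /(congr1 (@poly_rV _ n)); rewrite !rVpolyK.
- move=> Y /= sY; exists (poly_rV (Y - 'X^n)) => //.
  rewrite poly_rV_K ?subrK//; apply/leq_sizeP => i; rewrite leq_eqVlt.
  rewrite coefB coefXn => /orP[/eqP<-|ni].
    rewrite eqxx; have : Y`_n != 0.
      by rewrite -[n]/(n.+1.-1) -sY -lead_coefE lead_coef_eq0 -size_poly_eq0 sY.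
    by case/orP: (F2_case Y`_n) => /eqP->; rewrite ?eqxx ?subrr.
  by rewrite nth_default ?sY// gtn_eqF// subr0.
Qed.

Lemma coef_laurent_mul_poly (t : laurent) (p : {poly 'F_2}) (n : nat) (z : int) :
  (size p <= n)%N -> (t * polyK p) z = \sum_(i < n) t (z - i%:Z) * p`_i.
Proof.
move=> pn; rewrite mulrC.
change (Defs.conv (polyK p) t z = \sum_(i < n) t (z - i%:Z) * p`_i).
rewrite /Defs.conv -(fsbig_widen [set i%:Z | i in `I_n])//; last first.
  move=> [i|i] [_ /= ni]; last by rewrite mul0r.
  rewrite nth_default ?mul0r// (leq_trans pn)// leqNgt.
  by apply/negP => ?; case: ni; exists i.
rewrite fsbig_image; last by move=> i j _ _ /= [].
by rewrite -fsbig_ord; apply: eq_bigr => i _; rewrite mulrC.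
Qed.

(** [charE] reads the coefficient of [T^-1]; the terms of index [i] in [Z] and [j] in [Y] contribute
    to it through digit [i + j + 1] of [t], a persymmetric entry. *)
Lemma charE_bilinear (m n : nat) (t : laurent) (Y Z : {poly 'F_2}) :
  (size Y <= n)%N -> (size Z <= m)%N ->
  charE (t * polyK Y * polyK Z) =
  F2char (((\row_(i < m) Z`_i) *m persym m n (digits t) *m (\col_(j < n) Y`_j)) 0 0).
Proof.
move=> Yn Zm; congr ((-1) ^+ nat_of_ord _); rewrite (coef_laurent_mul_poly _ _ Zm) -mulmxA mxE.
apply: eq_bigr => i _; rewrite mxE mulrC; congr (_ * _).
rewrite (coef_laurent_mul_poly _ _ Yn) mxE; apply: eq_bigr => j _.
by rewrite !mxE /digits; congr (t _ * _); lia.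
Qed.

Definition persym_sum (m n : nat) (alpha : nat -> 'F_2) : int :=
  affine_F2char_sum (persym m n alpha) (\col_i alpha (i + n).+1)
    (\row_j alpha (m + j).+1) (alpha (m + n).+1)%:M.

Lemma persym_row_mx m n alpha :
  persym m (n + 1) alpha = row_mx (persym m n alpha) (\col_i alpha (i + n).+1).
Proof.
apply/matrixP => i j; rewrite !mxE; case: splitP => k; rewrite !mxE => ->//.
by rewrite ord1 addn0.
Qed.

Lemma persym_col_mx m n alpha :
  persym (m + 1) n alpha = col_mx (persym m n alpha) (\row_j alpha (m + j).+1).
Proof.
apply/matrixP => i j; rewrite !mxE; case: splitP => k; rewrite !mxE => ->//.
by rewrite ord1 addn0.
Qed.

Lemma persym_block_mx m n alpha :
  persym (m + 1) (n + 1) alpha =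
  block_mx (persym m n alpha) (\col_i alpha (i + n).+1)
    (\row_j alpha (m + j).+1) (alpha (m + n).+1)%:M.
Proof.
rewrite persym_col_mx persym_row_mx; congr col_mx.
apply/matrixP => i j; rewrite !mxE; case: splitP => k; rewrite !mxE => ->//.
by rewrite !ord1 eqxx mulr1n addn0.
Qed.

Lemma gsumE (m n : nat) (t : laurent) :
  gsum m.+1 n.+1 t = persym_sum m n (digits t).
Proof.
rewrite /gsum (fsbig_finType _ (size_polyF2_bij n)) /persym_sum /affine_F2char_sum.
(* The outer variable of the character sum is a column, while polynomials are coded by rows. *)
rewrite [RHS](reindex_onto trmx trmx) => [|u _]; last exact: trmxK.
rewrite [RHS](eq_bigl predT) => [|u]; last by rewrite trmxK eqxx.
apply: eq_bigr => y _; rewrite (fsbig_finType _ (size_polyF2_bij m)).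
apply: eq_bigr => z _.
have sz l (v : 'rV['F_2]_l) : (size (rVpoly v + 'X^l)%R <= l + 1)%N.
  by rewrite size_rVpolyDXn addn1.
rewrite (charE_bilinear _ (sz _ y) (sz _ z)) row_rVpolyDXn.
have -> : \col_(j < n + 1) (rVpoly y + 'X^n)`_j = col_mx y^T 1%:M.
  by apply: trmx_inj; rewrite tr_col_mx trmxK trmx1 -row_rVpolyDXn; apply/rowP => i; rewrite !mxE.
rewrite persym_block_mx mul_row_block mul_row_col !mul1mx !mulmx1 mulmxDl.
by congr (F2char (fun_of_matrix _ _ _)); rewrite addrACA addrA.
Qed.

(** * Ranks of persymmetric matrices *)

(** This condition is common to both nonzero cases; under it only the corner digit separates
    them. *)
Definition marginal_ranks_eq m n (alpha : nat -> 'F_2) : bool :=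
  (\rank (persym m n.+1 alpha) == \rank (persym m n alpha)) &&
  (\rank (persym m.+1 n alpha) == \rank (persym m n alpha)).

Lemma persym_sumE m n alpha :
  persym_sum m n alpha =
  if marginal_ranks_eq m n alpha then
    (if \rank (persym m.+1 n.+1 alpha) == \rank (persym m n alpha) then 1 else -1) *
    2 ^+ (m + (n - \rank (persym m n alpha)))
  else 0.
Proof.
rewrite /marginal_ranks_eq -(addn1 m) -(addn1 n) persym_block_mx.
by rewrite persym_row_mx persym_col_mx -affine_F2char_sumE.
Qed.

Lemma persym_ext m n alpha beta :
  (forall i, (0 < i < m + n)%N -> alpha i = beta i) ->
  persym m n alpha = persym m n beta.
Proof.
move=> ab; apply/matrixP => i j; rewrite !mxE ab//.
by have := ltn_ord i; have := ltn_ord j; lia.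
Qed.

(** The witness [e] is the product of [x] with the last column, where [x] expresses the last row
    through the rows of the block; it involves only the first [m + n] digits. Quantifying over
    [beta] lets the corner vary while these stay fixed. *)
Lemma rank_persym_corner m n alpha : marginal_ranks_eq m n alpha ->
  exists e, forall beta, (forall i, (0 < i <= m + n)%N -> alpha i = beta i) ->
  \rank (persym m.+1 n.+1 beta) =
    (\rank (persym m n alpha) + (beta (m + n).+1 != e))%N.
Proof.
rewrite /marginal_ranks_eq -(addn1 m) -(addn1 n) persym_row_mx persym_col_mx.
move=> /andP[/rank_row_mxP[y Ay] /rank_col_mxP[x xA]].
exists ((x *m \col_i alpha (i + n).+1) 0 0) => beta ab.
have -> : persym (m + 1) (n + 1) beta =
    block_mx (persym m n alpha) (\col_i alpha (i + n).+1)
      (\row_j alpha (m + j).+1) (beta (m + n).+1)%:M.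
  rewrite persym_block_mx; congr block_mx.
  - by apply: persym_ext => i ?; rewrite ab//; lia.
  - by apply/colP => i; rewrite !mxE ab//; have := ltn_ord i; lia.
  - by apply/rowP => i; rewrite !mxE ab//; have := ltn_ord i; lia.
rewrite (rank_block_mx _ xA Ay); congr (_ + ~~ _)%N.
by rewrite -[RHS]subr_eq0 !mxE eqxx mulr1n.
Qed.

Lemma equal_ranksE m n alpha j : equal_ranks m.+1 n.+1 alpha j =
  [&& marginal_ranks_eq m n alpha, \rank (persym m n alpha) == j &
      \rank (persym m.+1 n.+1 alpha) == j].
Proof.
rewrite /equal_ranks /marginal_ranks_eq /=.
by case: eqP => [->|_]; rewrite /= ?andbF // andbCA andbA.
Qed.

Lemma jump_ranksE m n alpha j : jump_ranks m.+1 n.+1 alpha j =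
  [&& marginal_ranks_eq m n alpha, \rank (persym m n alpha) == j &
      \rank (persym m.+1 n.+1 alpha) == j.+1].
Proof.
rewrite /jump_ranks /marginal_ranks_eq /=.
by case: eqP => [->|_]; rewrite /= ?andbF // andbCA andbA.
Qed.

(** Exactly one of the two corner digits keeps the rank, and the three smaller matrices do not
    contain that digit. *)
Lemma jump_ranks_flip m n alpha beta j :
  (forall i, (0 < i <= m + n)%N -> alpha i = beta i) ->
  beta (m + n).+1 = alpha (m + n).+1 + 1 ->
  jump_ranks m.+1 n.+1 alpha j = equal_ranks m.+1 n.+1 beta j.
Proof.
move=> ab flip; rewrite jump_ranksE equal_ranksE.
have pE m' n' : (m' + n' <= (m + n).+1)%N ->
    persym m' n' alpha = persym m' n' beta.
  by move=> mn; apply: persym_ext => i ?; apply: ab; lia.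
have -> : marginal_ranks_eq m n beta = marginal_ranks_eq m n alpha.
  by rewrite /marginal_ranks_eq !pE//; lia.
rewrite -(pE m n) ?leqnSn//; case: (boolP (marginal_ranks_eq _ _ _)) => //= mA.
have [e He] := rank_persym_corner mA; rewrite !He// flip.
have [->|_] //= := eqVneq (\rank _) j.
rewrite -(addn1 j) eqn_add2l -[X in _ = (_ == X)]addn0 eqn_add2l eqb0 eqb1 negbK.
by case/orP: (F2_case (alpha (m + n).+1)) => /eqP->; case/orP: (F2_case e) => /eqP->.
Qed.

(** An even power erases the sign, and only [j = \rank (persym m n alpha)] can contribute. There
    exactly one indicator is 1 if the marginal ranks agree; otherwise both sides vanish. *)
Lemma persym_sum_exprM2 m n q alpha : (0 < q)%N ->
  persym_sum m n alpha ^+ (2 * q) =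
  \sum_(j < m.+1) (equal_ranks m.+1 n.+1 alpha j + jump_ranks m.+1 n.+1 alpha j)%N%:R *
     2 ^+ ((m + n - j) * (2 * q)).
Proof.
move=> q0; set A := persym m n alpha.
have jm : (\rank A < m.+1)%N by rewrite ltnS rank_leq_row.
have jn : (\rank A <= n)%N by rewrite rank_leq_col.
rewrite (bigD1 (Ordinal jm))//= big1 ?addr0 => [|j]; last first.
  rewrite -val_eqE/= eq_sym => /negPf jE.
  by rewrite equal_ranksE jump_ranksE -/A jE andbF mul0r.
rewrite equal_ranksE jump_ranksE persym_sumE -/A eqxx /=.
case: ifP => [mA|_]; last by rewrite mul0r expr0n; lia.
have [e /(_ alpha (fun _ _ => erefl))] := rank_persym_corner mA.
rewrite -/A addnBA// => ->; case: (_ != e).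
  by rewrite addn1 eqn_leq ltnn eqxx mul1r mulN1r exprM sqrrN -!exprM mulnC.
by rewrite addn0 eqxx ltn_eqF// !mul1r -!exprM.
Qed.

Lemma sum_equal_ranks m n j :
  num_equal_ranks m.+1 n.+1 j = 
  (\sum_(v : (n.+1 + m.+1 - 1).-tuple 'F_2) equal_ranks m.+1 n.+1 (fun i => v`_i.-1)%R j)%N.
Proof. by rewrite /num_equal_ranks -sum1_card big_mkcond. Qed.

Lemma sum_jump_ranks m n j :
  (\sum_(v : (n.+1 + m.+1 - 1).-tuple 'F_2) jump_ranks m.+1 n.+1 (fun i => v`_i.-1)%R j)%N =
  num_equal_ranks m.+1 n.+1 j.
Proof.
rewrite sum_equal_ranks.
(* Position [m + n], counted from 0, holds the last digit, whose index counted from 1 is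
   [(m + n).+1]. *)
pose flip (v : (n.+1 + m.+1 - 1).-tuple 'F_2) :=
  [tuple tnth v i + (i == m + n :> nat)%:R | i < n.+1 + m.+1 - 1].
have flipE v i : (i < n.+1 + m.+1 - 1)%N ->
    (flip v)`_i = v`_i + (i == m + n)%:R.
  by move=> iN; rewrite -[i]/(val (Ordinal iN)) nth_mktuple (tnth_nth 0).
have flipK : involutive flip.
  move=> v; apply: eq_from_tnth => i; rewrite !tnth_mktuple -addrA.
  have F2D (b : bool) : b%:R + b%:R = 0 :> 'F_2 by case: b; apply: val_inj.
  by rewrite F2D addr0.
rewrite [RHS](reindex_inj (inv_inj flipK)); apply: eq_bigr => v _.
congr nat_of_bool; apply: jump_ranks_flip => /= [i imn|].
  have iN : (i.-1 < n.+1 + m.+1 - 1)%N by lia.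
  rewrite (flipE _ _ iN); have -> : (i.-1 == m + n)%N = false by apply/eqP; lia.
  by rewrite addr0.
have mnN : (m + n < n.+1 + m.+1 - 1)%N by lia.
by rewrite flipE// eqxx.
Qed.

(** * Integration of functions of finitely many digits *)

(** [Negz i] is [-(i + 1)], so entry [i] of [w] becomes digit [i + 1]; the default of [nth] pads
    with zeros. *)
Definition series_of_seq (w : seq 'F_2) (n : int) : 'F_2 :=
  if n is Negz i then w`_i else 0.

Lemma series_of_seq_laurent w : series_of_seq w \in laurent_pred.
Proof. by apply/asboolP; exists 0 => -[[|n]|n]. Qed.

Lemma series_of_seq_unit_ball w :
  Laurent (series_of_seq_laurent w) \in unit_ball.
Proof. by apply/unit_ballP => -[n|n]. Qed.

Definition PP_of_seq w : PP := MkPP (series_of_seq_unit_ball w).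

Lemma measurable_cyl w : measurable (cyl w).
Proof. by apply: sub_sigma_algebra; exact: open_cyl. Qed.

(** Series add digit by digit without carries, so the translation turns a zero prefix into the
    prefix [w]. *)
Lemma cyl_translate w :
  [set PP_of_seq w + t | t in cyl (nseq (size w) 0)] = cyl w.
Proof.
apply/seteqP; split=> [_ [t t0 <-] i iw|t tw].
  change (w`_i + t (- i.+1%:Z) = w`_i).
  by rewrite t0 ?size_nseq// nth_nseq iw addr0.
exists (t - PP_of_seq w); last by rewrite addrC subrK.
move=> i; rewrite size_nseq => iw.
change (t (- i.+1%:Z) - w`_i = (nseq (size w) 0)`_i).
by rewrite tw// subrr nth_nseq iw.
Qed.

Definition leading_digits N (t : PP) : N.-tuple 'F_2 := [tuple t (- i.+1%:Z) | i < N].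

Lemma cylP N (w : N.-tuple 'F_2) t : cyl w t <-> w = leading_digits N t.
Proof.
split=> [tw|->].
  apply: eq_from_tnth => i; rewrite tnth_mktuple (tnth_nth 0) tw//.
  by rewrite size_tuple.
move=> i; rewrite size_tuple => iN.
by rewrite -[i]/(val (Ordinal iN)) nth_mktuple.
Qed.

Section haar_integral.
Context (R : realType) (mu : {measure set PP -> \bar R}).

(** The integrand is a finite combination of indicators of cylinders; nonnegativity allows sum and
    integral to be exchanged. *)
Lemma integral_leading_digits N (g : N.-tuple 'F_2 -> R) : (forall w, 0 <= g w) ->
  (\int[mu]_(t in [set: PP]) (g (leading_digits N t))%:E =
   \sum_(w : N.-tuple 'F_2) (g w)%:E * mu (cyl w))%E.
Proof.
move=> g0.
transitivity (\int[mu]_(t in [set: PP])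
    \sum_(w : N.-tuple 'F_2) ((g w)%:E * (\1_(cyl w) t)%:E))%E.
  apply: eq_integral => t _.
  rewrite (bigD1 (leading_digits N t))// big1 => [|w wt].
    by rewrite indicE (mem_set ((cylP _ _).2 erefl)) mule1 /= addr0.
  rewrite indicE memNset ?mule0// => /cylP wE.
  by rewrite wE eqxx in wt.
rewrite ge0_integral_sum//.
- apply: eq_bigr => w _; rewrite ge0_integralZl//.
  + by rewrite integral_indic// ?setIT//; exact: measurable_cyl.
  + by apply/measurable_EFinP; apply: measurable_indic; exact: measurable_cyl.
  + by rewrite lee_fin.
- move=> w; apply: emeasurable_funM => //.
  by apply/measurable_EFinP; apply: measurable_indic; exact: measurable_cyl.
- by move=> w t _; rewrite mule_ge0// lee_fin.
Qed.

Lemma haar_cyl w : is_haar mu -> mu (cyl w) = (2 ^- size w)%:E.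
Proof.
move=> [muT mu1].
have muE v : mu (cyl v) = mu (cyl (nseq (size v) 0)).
  by rewrite -[in LHS]cyl_translate muT//; exact: measurable_cyl.
rewrite muE; set N := size w; set c := mu _.
have cfin : c \is a fin_num.
  rewrite ge0_fin_numE ?measure_ge0// (@le_lt_trans _ _ 1%E) ?ltry//.
  rewrite -mu1; apply: le_measure; rewrite ?inE//; exact: measurable_cyl.
(* Integrating the constant 1 over the [2 ^ N] cylinders of length [N], all of mass [c], gives
   [1 = c * 2 ^ N]. *)
have := @integral_leading_digits N (fun=> 1) (fun=> ler01).
rewrite integral_cst// mul1e mu1.
under eq_bigr => v _ do rewrite mul1e muE size_tuple -/c -(fineK cfin).
rewrite sumEFin sumr_const card_tuple card_Fp// => /esym[] cN.
rewrite -(fineK cfin); congr EFin; apply: (@mulIf _ (2 ^+ N)).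
  by rewrite expf_neq0// pnatr_eq0.
by rewrite mulVf ?expf_neq0 ?pnatr_eq0// -natrX mulr_natr.
Qed.

Lemma haar_integral_leading_digits N (g : N.-tuple 'F_2 -> R) :
  is_haar mu -> (forall w, 0 <= g w) ->
  (\int[mu]_(t in [set: PP]) (g (leading_digits N t))%:E =
   (2 ^- N * \sum_(w : N.-tuple 'F_2) g w)%:E)%E.
Proof.
move=> haar_mu g0; rewrite integral_leading_digits// mulr_sumr -sumEFin.
by apply: eq_bigr => w _; rewrite (haar_cyl _ haar_mu) size_tuple -EFinM mulrC.
Qed.

End haar_integral.

(** * Values and even moments of [gsum] *)

Lemma persym_sum_ext m n alpha beta :
  (forall i, (0 < i < (m + n).+2)%N -> alpha i = beta i) ->
  persym_sum m n alpha = persym_sum m n beta.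
Proof.
move=> ab; rewrite !persym_sumE /marginal_ranks_eq.
rewrite !(persym_ext (alpha := alpha) (beta := beta))// => i ?; apply: ab; lia.
Qed.

Theorem theorem1p5 (R : realType) (s k q : nat)
  (hs : (2 <= s)%N) (hk : (2 <= k)%N) (hq : (1 <= q)%N)
  (mu : {measure set PP -> \bar R}) (hmu : is_haar mu) :
  (forall t : PP,
    [/\ forall j : nat, equal_ranks s k (digits t) j ->
          gsum s k t = 2 ^+ (s + k - j - 2),
        forall j : nat, jump_ranks s k (digits t) j ->
          gsum s k t = - 2 ^+ (s + k - j - 2)
      & (forall j : nat, ~~ equal_ranks s k (digits t) j /\
                         ~~ jump_ranks s k (digits t) j) ->
          gsum s k t = 0]) /\
  (\int[mu]_(t in [set: PP]) ((gsum s k t)%:~R ^+ (2 * q) : R)%:E =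
    (2 ^+ ((s + k - 2) * (2 * q - 1)) *
      \sum_(j < s) (num_equal_ranks s k j)%:R * 2 ^- (2 * q * j) : R)%:E)%E.
Proof.
case: s k hs hk => [|m]// [|n]// _ _; split=> [t|].
  rewrite gsumE persym_sumE; set A := persym m n _.
  have jm : (\rank A <= m)%N by rewrite rank_leq_row.
  have jn : (\rank A <= n)%N by rewrite rank_leq_col.
  split=> [j|j|H].
  - rewrite equal_ranksE => /and3P[-> /eqP<- ->]; rewrite -/A mul1r.
    by congr (_ ^+ _); lia.
  - rewrite jump_ranksE => /and3P[-> /eqP<- /eqP->].
    by rewrite -/A gtn_eqF// mulN1r; congr (- _ ^+ _); lia.
  (* At [j = \rank A] the full matrix can only have rank [j] or [j + 1], so one of the two patterns
     holds, against [H]. *)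
  - case: ifP => // mA; have [] := H (\rank A).
    rewrite equal_ranksE jump_ranksE -/A mA eqxx /=.
    have [e /(_ _ (fun _ _ => erefl)) ->] := rank_persym_corner mA.
    by rewrite -/A; case: (_ != e); rewrite ?addn1 ?addn0 eqxx.
set N := (n.+1 + m.+1 - 1)%N.
pose alpha (w : N.-tuple 'F_2) i := w`_i.-1.
pose g w : R := (persym_sum m n (alpha w))%:~R ^+ (2 * q).
have -> : (\int[mu]_(t in [set: PP]) ((gsum m.+1 n.+1 t)%:~R ^+ (2 * q) : R)%:E
    = \int[mu]_(t in [set: PP]) (g (leading_digits N t))%:E)%E.
  apply: eq_integral => t _; rewrite gsumE /g; congr ((_%:~R ^+ _)%:E).
  apply: persym_sum_ext => i ib; rewrite /alpha.
  have iN : (i.-1 < N)%N by rewrite /N; lia.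
  rewrite -[i.-1]/(val (Ordinal iN)) nth_mktuple /digits /=.
  by congr (t _); lia.
rewrite haar_integral_leading_digits// => [|w]; last by rewrite /g exprM exprn_ge0// sqr_ge0.
congr EFin.
have gE w : g w = \sum_(j < m.+1) (equal_ranks m.+1 n.+1 (alpha w) j +
    jump_ranks m.+1 n.+1 (alpha w) j)%N%:R * 2 ^+ ((m + n - j) * (2 * q)).
  rewrite /g -rmorphXn /= persym_sum_exprM2// rmorph_sum /=; apply: eq_bigr => j _.
  by rewrite rmorphM rmorphXn /= rmorph_nat.
under eq_bigr do rewrite gE.
rewrite exchange_big /= !mulr_sumr; apply: eq_bigr => j _.
(* The equal and jump counts coincide, so each [j] carries twice [num_equal_ranks]; this 2 turns
   [2 ^- N] into [2 ^- (m + n)]. *)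
rewrite -mulr_suml -natr_sum big_split /= -sum_equal_ranks sum_jump_ranks.
rewrite addnn -mul2n natrM.
have jm := ltn_ord j.
have NE : N = (m + n).+1 by rewrite /N; lia.
have -> : (m.+1 + n.+1 - 2 = m + n)%N by lia.
rewrite NE exprS.
have n0 i : 2 ^+ i != 0 :> R by rewrite expf_neq0// pnatr_eq0.
(* The split exposes the factor [2 ^+ (m + n)] that cancels the remaining mass; [j <= m] and
   [1 <= q] keep the truncated subtractions exact. *)
have -> : 2 ^+ ((m + n - j) * (2 * q)) =
    2 ^+ ((m + n) * (2 * q - 1)) * 2 ^+ (m + n) / 2 ^+ (2 * q * j) :> R.
  by apply: (mulIf (n0 (2 * q * j)%N)); rewrite divfK// -!exprD; congr (_ ^+ _); nia.
by field; rewrite !n0.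
Qed.
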